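(* Let $G$ be a connected graph and $H$ any graph. Then $\xi(G\odot H)=\mathrm{n}(G)$ if and only if either $\beta(\widehat{G})=0$, or ($\mathrm{n}(H)=1$ and $\beta^*(G)=0$).
   Context: All graphs are finite, simple and undirected; $\mathrm{n}(H)$ denotes the order of $H$. For a connected graph $\Gamma$, a set $S\subseteq V(\Gamma)$ is a distance-equalizer set if for every two distinct $u,v\in V(\Gamma)\setminus S$ there is $w\in S$ with $d_\Gamma(w,u)=d_\Gamma(w,v)$; $\xi(\Gamma)$ is the minimum cardinality of a distance-equalizer set of $\Gamma$. For $V(G)=\{v_1,\dots,v_n\}$, the corona product $G\odot H$ is obtained from $G$ and $n$ pairwise disjoint copies $H_1,\dots,H_n$ of $H$ by joining $v_i$ to every vertex of $H_i$. The empty bisector graph $\widehat{G}$ has vertex set $V(G)$, with distinct $u,v$ adjacent iff there is no $w\in V(G)$ with $d_G(w,u)=d_G(w,v)$. $\beta$ denotes the vertex cover number. A pair $(X,Y)$ of subsets of $V(G)$ with $X\cup Y=V(G)$ is a forward-equalized pair of $G$ if for every $(u,v)\in (X\setminus Y)\times(Y\setminus X)$ there exists $w\in V(G)$ with $d_G(w,u)=d_G(w,v)+1$. $\beta^*(G)=\min\{|X\cap Y| : X,Y \text{ vertex covers of } \widehat{G},\ (X,Y) \text{ a forward-equalized pair of } G\}$. *)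

(* Defs.v *)
From HB Require Import structures.
From mathcomp Require Import all_boot.

Set Implicit Arguments.
Unset Strict Implicit.
Unset Printing Implicit Defensive.

Record sgraph := SGraph {
  vertex :> finType;
  edge : rel vertex;
  edge_sym : symmetric edge;
  edge_irrefl : irreflexive edge }.

Definition connected_graph (G : sgraph) : Prop :=
  0 < #|G| /\ forall x y : G, connect (@edge G) x y.

(* The least length of a walk from x to y; a shortest walk has fewer than #|G|
   edges, so searching the lengths below #|G| suffices.  The junk value when x
   and y lie in different components is #|G|. *)
Definition walkb (G : sgraph) (x y : G) (k : nat) : bool :=
  [exists p : k.-tuple G, path (@edge G) x p && (last x p == y)].

Definition dist (G : sgraph) (x y : G) : nat :=
  find (walkb x y) (iota 0 #|G|).

Lemma dist_walk (G : sgraph) (x y : G) :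
  connect (@edge G) x y -> walkb x y (dist x y).
Proof.
move=> /connectP[p0 p0P ->]; case/shortenP: p0P => p pP pU _.
have w : walkb x (last x p) (size p).
  by apply/existsP; exists (in_tuple p); rewrite /= pP eqxx.
have lt_p : size p < #|G| by rewrite -[_.+1]/(size (x :: p)) -(card_uniqP pU) max_card.
have hs : has (walkb x (last x p)) (iota 0 #|G|).
  by apply/hasP; exists (size p); rewrite // mem_iota.
by have := nth_find 0 hs; rewrite nth_iota // -[X in _ < X](size_iota 0) -has_find.
Qed.

Lemma dist_min (G : sgraph) (x : G) (p : seq G) :
  path (@edge G) x p -> dist x (last x p) <= size p.
Proof.
move=> pP; rewrite leqNgt; apply/negP => lt_p.
have lt_G : size p < #|G|.
  by rewrite (leq_trans lt_p) // -[X in _ <= X](size_iota 0) find_size.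
have := before_find 0 lt_p; rewrite nth_iota // add0n.
suff -> : walkb x (last x p) (size p) by [].
by apply/existsP; exists (in_tuple p); rewrite /= pP eqxx.
Qed.

Definition distance_equalizer (G : sgraph) (S : {set G}) : bool :=
  [forall u, forall v,
     [&& u \notin S, v \notin S & u != v] ==>
     [exists w in S, dist w u == dist w v]].

Definition xi (G : sgraph) : nat :=
  #|[arg min_(S < [set: G] | distance_equalizer S) #|S| ]|.

Lemma distance_equalizerT (G : sgraph) : distance_equalizer [set: G].
Proof. by apply/forallP => u; apply/forallP => v; rewrite inE. Qed.

(* inl v is the vertex v of G; inr (v, h) is the vertex h in the copy of H
   attached to v. *)
Definition corona_edge (G H : sgraph) : rel (G + G * H) :=
  fun a b => match a, b with
  | inl u, inl v => edge u v
  | inl u, inr (v, _) => u == v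
  | inr (u, _), inl v => u == v
  | inr (u, h), inr (v, k) => (u == v) && edge h k
  end.

Lemma corona_edge_sym (G H : sgraph) : symmetric (@corona_edge G H).
Proof.
by case=> [u|[u h]] [v|[v k]] /=; rewrite ?(eq_sym u) // edge_sym.
Qed.

Lemma corona_edge_irrefl (G H : sgraph) : irreflexive (@corona_edge G H).
Proof. by case=> [u|[u h]] /=; rewrite edge_irrefl ?andbF. Qed.

Definition corona (G H : sgraph) : sgraph :=
  SGraph (@corona_edge_sym G H) (@corona_edge_irrefl G H).

Definition bisector_edge (G : sgraph) : rel G :=
  fun u v => (u != v) && ~~ [exists w, dist w u == dist w v].

Lemma bisector_edge_sym (G : sgraph) : symmetric (@bisector_edge G).
Proof.
move=> u v; rewrite /bisector_edge eq_sym; congr (_ && ~~ _).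
by apply: eq_existsb => w; rewrite eq_sym.
Qed.

Lemma bisector_edge_irrefl (G : sgraph) : irreflexive (@bisector_edge G).
Proof. by move=> u; rewrite /bisector_edge eqxx. Qed.

Definition empty_bisector (G : sgraph) : sgraph :=
  SGraph (@bisector_edge_sym G) (@bisector_edge_irrefl G).

Definition vertex_cover (G : sgraph) (S : {set G}) : bool :=
  [forall u, forall v, edge u v ==> (u \in S) || (v \in S)].

Definition beta (G : sgraph) : nat :=
  #|[arg min_(S < [set: G] | vertex_cover S) #|S| ]|.

Lemma vertex_coverT (G : sgraph) : vertex_cover [set: G].
Proof. by apply/forallP => u; apply/forallP => v; rewrite inE implybT. Qed.

Definition forward_equalized (G : sgraph) (X Y : {set G}) : bool :=
  (X :|: Y == [set: G]) &&
  [forall u in X :\: Y, forall v in Y :\: X,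
     exists w, dist w u == (dist w v).+1].

Definition beta_star_admissible (G : sgraph) (p : {set G} * {set G}) : bool :=
  [&& @vertex_cover (empty_bisector G) p.1,
      @vertex_cover (empty_bisector G) p.2
    & forward_equalized p.1 p.2].

Definition beta_star (G : sgraph) : nat :=
  let p := [arg min_(p < ([set: G], [set: G]) | beta_star_admissible p)
             #|p.1 :&: p.2| ] in
  #|p.1 :&: p.2|.

Lemma beta_star_admissibleT (G : sgraph) :
  beta_star_admissible ([set: G], [set: G]).
Proof.
rewrite /beta_star_admissible /= (@vertex_coverT (empty_bisector G)) /=.
rewrite /forward_equalized setUT eqxx /=.
by apply/forall_inP => u; rewrite !inE.
Qed.

(* Main.v *)
(* Write block v for the vertex v of G together with its copy of H.  Every way
   into a copy leads through its vertex v, so a vertex of the corona outside the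
   copy is one step nearer to v than to the vertices of the copy.  Hence only a
   vertex of the copy, adjacent to h, can equalize v and a vertex h of the copy,
   and every distance-equalizer set meets every block: xi is n(G) iff some
   section of the projection onto G has a distance-equalizer range S.
   If n(H) >= 2, such an S misses a vertex of every copy; equalizing these
   vertices across two blocks gives an equidistant vertex of G, i.e. the empty
   bisector graph has no edge, and conversely the section v |-> v then works.
   If n(H) = 1, a section chooses between v and its leaf in each block; with X
   the set of v whose leaf is chosen, its range is a distance-equalizer set iff
   (X, V(G) \ X) is admissible for beta_star. *)
Require Import Defs.
From mathcomp Require Import all_boot.

Set Implicit Arguments.
Unset Strict Implicit.
Unset Printing Implicit Defensive.

Lemma arg_min_eq (T : finType) (P : pred T) (F : T -> nat) (i0 : T) (n : nat) :
    P i0 -> (forall i, P i -> n <= F i) ->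
  F [arg min_(i < i0 | P i) F i] = n <-> exists2 i, P i & F i = n.
Proof.
move=> Pi0 n_le; case: arg_minnP => // i Pi F_min.
split=> [Fi|[j Pj Fj]]; first by exists i.
by apply/eqP; rewrite eqn_leq n_le // -Fj F_min.
Qed.

Arguments arg_min_eq {T} P F {i0 n}.

Lemma exists_in_imset (aT rT : finType) (f : aT -> rT) (A : {set aT})
    (P : pred rT) :
  [exists y in f @: A, P y] = [exists x in A, P (f x)].
Proof.
apply/exists_inP/exists_inP => [[_ /imsetP[x xA ->] Px]|[x xA Px]].
  by exists x.
by exists (f x); rewrite ?imset_f.
Qed.

Lemma exists_in_setT (T : finType) (P : pred T) :
  [exists x in [set: T], P x] = [exists x, P x].
Proof. by apply: eq_existsb => x; rewrite inE. Qed.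

Section Distance.

Variable G : sgraph.
Implicit Types x y z : G.

Lemma distxx x : dist x x = 0.
Proof. by apply/eqP; rewrite -leqn0 (@dist_min _ x [::]). Qed.

Hypothesis G_conn : connected_graph G.

Lemma shortest_path x y :
  exists p, [/\ path (@edge G) x p, last x p = y & size p = dist x y].
Proof.
have /existsP[p /andP[p_path /eqP p_last]] := dist_walk (G_conn.2 x y).
by exists p; rewrite size_tuple.
Qed.

Lemma dist_eq0 x y : (dist x y == 0) = (x == y).
Proof.
apply/eqP/eqP => [|->]; last exact: distxx.
by have [p [_ <- <-]] := shortest_path x y => /size0nil->.
Qed.

Lemma dist_sym x y : dist x y = dist y x.
Proof.
suff dist_le (u v : G) : dist v u <= dist u v.
  by apply/eqP; rewrite eqn_leq !dist_le.
have [p [p_path <- <-]] := shortest_path u v.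
have rev_p_path : path (@edge G) (last u p) (rev (belast u p)).
  by rewrite rev_path (eq_path (e' := @edge G)) // => a b; apply: edge_sym.
have := dist_min rev_p_path.
rewrite size_rev size_belast; case: p {p_path rev_p_path} => //= z p.
by rewrite rev_cons last_rcons.
Qed.

Lemma dist_edge x y z : edge y z -> dist x z <= (dist x y).+1.
Proof.
move=> yz; have [p [p_path p_last <-]] := shortest_path x y.
rewrite -(size_rcons p z) -[X in dist x X](last_rcons x p z) dist_min //.
by rewrite rcons_path p_path p_last.
Qed.

Lemma dist_pred x y n : dist x y = n.+1 -> exists2 z, edge z y & dist x z = n.
Proof.
move=> xy; have [p [p_path p_last]] := shortest_path x y; rewrite xy.
case/lastP: p p_path p_last => // p t.
rewrite rcons_path last_rcons size_rcons => /andP[p_path edge_t] ty [size_p].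
rewrite ty in edge_t; exists (last x p) => //.
apply/eqP; rewrite eqn_leq -{1}size_p dist_min //=.
by rewrite -ltnS -xy dist_edge.
Qed.

Lemma dist_eq1 x y : (dist x y == 1) = edge x y.
Proof.
apply/eqP/idP => [/dist_pred[z zy /eqP]|xy].
  by rewrite dist_eq0 => /eqP->.
have le1 : dist x y <= 1 by rewrite -(distxx x) dist_edge.
apply/eqP; rewrite eqn_leq le1 lt0n dist_eq0.
by apply: contraL xy => /eqP->; rewrite edge_irrefl.
Qed.

End Distance.

Lemma dist_contract (G G' : sgraph) (f : G -> G') :
    connected_graph G -> connected_graph G' ->
    (forall x y, edge x y -> (f x == f y) || edge (f x) (f y)) ->
  forall x y, dist (f x) (f y) <= dist x y.
Proof.
move=> G_conn G'_conn f_edge x y; move: {2}(dist x y) (erefl (dist x y)) => n.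
elim: n y => [|n IHn] y xy.
  by move/eqP: xy; rewrite dist_eq0 // => /eqP->; rewrite distxx.
have [z zy xz] := dist_pred G_conn xy.
have le_n : dist (f x) (f z) <= n by rewrite -[X in _ <= X]xz IHn.
rewrite xy; have /orP[/eqP<-|fzy] := f_edge z y zy; first exact: leqW.
by apply: leq_trans (dist_edge G'_conn _ fzy) _.
Qed.

Lemma vertex_coverP (G : sgraph) (S : {set G}) :
  reflect (forall u v : G, u \notin S -> v \notin S -> ~~ edge u v)
          (vertex_cover S).
Proof.
apply: (iffP forallP) => [covS u v uS vS|indep u].
  by have /forallP/(_ v) := covS u; rewrite (negPf uS) (negPf vS) implybF.
apply/forallP=> v; apply/implyP; apply: contraLR.
by rewrite negb_or => /andP[]; apply: indep.
Qed.

Lemma beta_eq0 (G : sgraph) : beta G = 0 <-> vertex_cover (set0 : {set G}).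
Proof.
pose card_set (S : {set G}) := #|S|.
apply: (iff_trans (arg_min_eq _ card_set (vertex_coverT G) _)) => //.
split=> [[S covS /cards0_eq S0]|cov0]; first by rewrite -S0.
by exists set0; rewrite // /card_set cards0.
Qed.

Lemma xi_eq (G : sgraph) (n : nat) :
    (forall S : {set G}, distance_equalizer S -> n <= #|S|) ->
  xi G = n <-> exists2 S : {set G}, distance_equalizer S & #|S| = n.
Proof.
pose card_set (S : {set G}) := #|S|.
exact: (arg_min_eq _ card_set (distance_equalizerT G)).
Qed.

Section EqualizedPairs.

Variable G : sgraph.
Implicit Types (u v : G) (S X : {set G}).

Definition equalized S u v : bool := [exists w in S, dist w u == dist w v].

Definition forward S u v : bool := [exists w in S, dist w u == (dist w v).+1].

Lemma equalizedC S u v : equalized S u v = equalized S v u.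
Proof. by apply: eq_existsb => w; rewrite eq_sym. Qed.

Lemma equalizedTxx u : equalized [set: G] u u.
Proof. by apply/exists_inP; exists u; rewrite ?inE. Qed.

Lemma distance_equalizerP S :
  reflect (forall u v, u \notin S -> v \notin S -> u != v -> equalized S u v)
          (distance_equalizer S).
Proof.
apply: (iffP forallP) => [eqS u v uS vS uv|eqS u].
  by have /forallP/(_ v) := eqS u; rewrite uS vS uv.
by apply/forallP=> v; apply/implyP=> /and3P[]; apply: eqS.
Qed.

Lemma bisector_edgeE u v : bisector_edge u v = ~~ equalized [set: G] u v.
Proof.
rewrite /equalized exists_in_setT /bisector_edge; case: eqVneq => // ->.
by symmetry; apply/negbTE; rewrite negbK; apply/existsP; exists v.
Qed.

Lemma vertex_cover_bisectorP S :
  reflect (forall u v, u \notin S -> v \notin S -> equalized [set: G] u v)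
          (@vertex_cover (empty_bisector G) S).
Proof.
have coverP := @vertex_coverP (empty_bisector G) S.
apply: (iffP coverP) => covS u v uS vS.
  by rewrite -[equalized _ _ _]negbK -bisector_edgeE covS.
by rewrite /= bisector_edgeE negbK covS.
Qed.

Lemma beta_empty_bisector_eq0 :
  beta (empty_bisector G) = 0 <-> forall u v, equalized [set: G] u v.
Proof.
apply: (iff_trans (beta_eq0 _)).
split=> [/vertex_cover_bisectorP eqT u v|eqT].
  by rewrite eqT ?inE.
exact/vertex_cover_bisectorP.
Qed.

Lemma beta_star_admissible_setCP X :
  reflect [/\ forall u v, u \notin X -> v \notin X -> equalized [set: G] u v,
              forall u v, u \in X -> v \in X -> equalized [set: G] u v
            & forall u v, u \in X -> v \notin X -> forward [set: G] u v]
          (beta_star_admissible (X, ~: X)).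
Proof.
apply: (iffP and3P) => [[covX covXC /andP[_ fwd]]|[eqXC eqX fwd]].
  split=> u v uX vX; first exact: (vertex_cover_bisectorP X covX).
    by apply: (vertex_cover_bisectorP (~: X) covXC); rewrite inE negbK.
  rewrite /forward exists_in_setT; apply: (forall_inP (forall_inP fwd u _) v _).
    by rewrite !inE uX.
  by rewrite !inE vX.
split; first exact/vertex_cover_bisectorP.
  by apply/vertex_cover_bisectorP=> u v; rewrite !inE !negbK; apply: eqX.
rewrite /forward_equalized setUCr eqxx /=.
apply/forall_inP=> u; rewrite !inE negbK andbb => uX.
apply/forall_inP=> v; rewrite !inE andbb => vX.
by rewrite -exists_in_setT; apply: fwd.
Qed.

Lemma beta_star_eq0 :
  beta_star G = 0 <-> exists X, beta_star_admissible (X, ~: X).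
Proof.
pose overlap (p : {set G} * {set G}) := #|p.1 :&: p.2|.
apply: (iff_trans (arg_min_eq _ overlap (beta_star_admissibleT G) _)) => //.
split=> [[[X Y] /= admXY /cards0_eq XY0]|[X admX]]; last first.
  by exists (X, ~: X); rewrite // /overlap setICr cards0.
exists X; have /and3P[_ _ /andP[/eqP/= XYT _]] := admXY.
suff -> : ~: X = Y by [].
apply/setP=> v; move/setP/(_ v): XYT; move/setP/(_ v): XY0; rewrite !inE.
by case: (v \in X); case: (v \in Y).
Qed.

End EqualizedPairs.

Section Corona.

Variables G H : sgraph.
Hypothesis G_conn : connected_graph G.
Implicit Types (u v : G) (h k : H) (w : corona G H) (S : {set corona G H}).

Definition block w : G := match w with inl v => v | inr (v, _) => v end.

Definition depth w : nat := if w is inl _ then 0 else 1.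

Definition copy v : {set corona G H} :=
  [set w | if w is inr (u, _) then u == v else false].

Definition missed S : {set G} := [set v | inl v \notin S].

Lemma mem_copy w v : (w \in copy v) = (w != inl v) && (block w == v).
Proof. by case: w => [u|[u h]]; rewrite inE //; apply/esym/andNb. Qed.

Lemma connected_corona : connected_graph (corona G H).
Proof.
have /card_gt0P[v0 _] := G_conn.1.
split; first by apply/card_gt0P; exists (inl v0).
have block_conn w : connect (@edge (corona G H)) (inl (block w)) w.
  by case: w => [v|[v h]] //; rewrite connect1 //= eqxx.
have base_conn u v : connect (@edge (corona G H)) (inl u) (inl v).
  have /connectP[p p_path ->] := G_conn.2 u v.
  by apply/connectP; exists (map inl p); rewrite ?path_map ?last_map.
move=> w w'; apply: connect_trans (block_conn w').
apply: connect_trans (base_conn (block w) _).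
by rewrite (sym_connect_sym (@edge_sym _)).
Qed.

Lemma dist_copy w v h :
  w \notin copy v -> dist w (inr (v, h)) = (dist w (inl v)).+1.
Proof.
move=> w_out; have corona_conn := connected_corona.
have le_succ : dist w (inr (v, h)) <= (dist w (inl v)).+1.
  by apply: dist_edge => //; apply: eqxx.
suff gt_inl n k : dist w (inr (v, k)) = n -> dist w (inl v) < n.
  by apply/eqP; rewrite eqn_leq le_succ (gt_inl _ h).
elim: n k => [|n IHn] k wk.
  by move/eqP: wk w_out; rewrite dist_eq0 // => /eqP->; rewrite inE eqxx.
have [[u|[u l]] + wz] := dist_pred corona_conn wk => [/eqP uv|/andP[/eqP uv _]].
  by rewrite -wz uv.
by rewrite ltnS ltnW // (IHn l) // -uv.
Qed.

Lemma dist_inl u v : dist (inl u : corona G H) (inl v) = dist u v.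
Proof.
have corona_conn := connected_corona.
apply/eqP; rewrite eqn_leq; apply/andP; split.
  apply: (@dist_contract G (corona G H) inl) => // x y xy.
  by rewrite /= xy orbT.
apply: (@dist_contract (corona G H) G block) => //.
by case=> [x|[x h]] [y|[y k]] /= => [->|->|->|/andP[->]] //; rewrite orbT.
Qed.

Lemma dist_corona_inl w v : dist w (inl v) = dist (block w) v + depth w.
Proof.
case: w => [u|[u h]] /=; first by rewrite dist_inl addn0.
rewrite dist_sym ?dist_copy ?dist_inl ?inE //; last exact: connected_corona.
by rewrite addn1 dist_sym.
Qed.

Lemma equalized_inl S u v :
  equalized S (inl u) (inl v) = equalized (block @: S) u v.
Proof.
rewrite /equalized exists_in_imset; apply: eq_existsb => w.
by rewrite !dist_corona_inl eqn_add2r.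
Qed.

Lemma forward_inl S u v :
  forward S (inl u) (inl v) = forward (block @: S) u v.
Proof.
rewrite /forward exists_in_imset; apply: eq_existsb => w.
by rewrite !dist_corona_inl -addSn eqn_add2r.
Qed.

Lemma equalized_inl_inr S u v k : [disjoint S & copy v] ->
  equalized S (inl u) (inr (v, k)) = forward (block @: S) u v.
Proof.
move=> Sv; rewrite -forward_inl; apply: eq_existsb => w.
by apply: andb_id2l => wS; rewrite dist_copy // (disjointFr Sv).
Qed.

Lemma equalized_inr S u v h k :
    [disjoint S & copy u] -> [disjoint S & copy v] ->
  equalized S (inr (u, h)) (inr (v, k)) = equalized (block @: S) u v.
Proof.
move=> Su Sv; rewrite -equalized_inl; apply: eq_existsb => w.
apply: andb_id2l => wS.
by rewrite !dist_copy ?eqSS // ?(disjointFr Su) ?(disjointFr Sv).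
Qed.

Lemma equalizer_copy_neighbor S v h : distance_equalizer S ->
    inl v \notin S -> inr (v, h) \notin S ->
  exists2 w, w \in S :&: copy v & edge w (inr (v, h)).
Proof.
move=> /distance_equalizerP eqS vS hS.
have /exists_inP[w wS /eqP w_eq] := eqS _ _ vS hS isT.
have wv : w \in copy v.
  by apply: contraT => /(dist_copy h)/eqP; rewrite -w_eq eqn_leq ltnn andbF.
exists w; first by rewrite inE wS.
rewrite -(dist_eq1 connected_corona) -w_eq (dist_eq1 connected_corona).
by case: w wv {wS w_eq} => [u|[u k]]; rewrite inE.
Qed.

Lemma block_equalizer S :
  0 < #|H| -> distance_equalizer S -> block @: S = [set: G].
Proof.
move=> /card_gt0P[h _] eqS; apply/setP=> v; rewrite inE; apply/imsetP.
have [vS|vS] := boolP (inl v \in S); first by exists (inl v).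
have [hS|hS] := boolP (inr (v, h) \in S); first by exists (inr (v, h)).
have [w /setIP[wS wv] _] := equalizer_copy_neighbor eqS vS hS.
by exists w => //; move: wv; rewrite mem_copy => /andP[_ /eqP].
Qed.

Lemma xi_corona_eq_order : 0 < #|H| ->
  xi (corona G H) = #|G| <->
  exists2 s : G -> corona G H, cancel s block
                             & distance_equalizer (s @: [set: G]).
Proof.
move=> H_gt0; apply: (iff_trans (xi_eq _)).
  by move=> S /(block_equalizer H_gt0) bS; rewrite -cardsT -bS leq_imset_card.
split=> [[S eqS cardS]|[s sK eqS]]; last first.
  exists (s @: [set: G]) => //.
  by rewrite card_imset ?cardsT //; apply: can_inj sK.
have block_onto v : v \in [seq block w | w in S].
  have /imsetP[w wS ->] : v \in block @: S by rewrite block_equalizer ?inE.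
  exact: image_f.
pose s v := iinv (block_onto v).
have sK : cancel s block by move=> v; apply: f_iinv.
have sS : s @: [set: G] \subset S.
  by apply/subsetP=> _ /imsetP[v _ ->]; apply: mem_iinv.
exists s => //; suff /eqP-> : s @: [set: G] == S by [].
by rewrite eqEcard sS /= card_imset ?cardsT ?cardS //; apply: can_inj sK.
Qed.

Section SectionOfBlock.

Variable s : G -> corona G H.
Hypothesis sK : cancel s block.

Local Notation S := (s @: [set: G]).

Lemma mem_section w : (w \in S) = (s (block w) == w).
Proof.
apply/imsetP/eqP => [[v _ ->]|<-]; first by rewrite sK.
by exists (block w).
Qed.

Lemma block_section : block @: S = [set: G].
Proof. by rewrite -imset_comp (eq_imset _ sK) imset_id. Qed.

Lemma disjoint_section_copy v : inl v \in S -> [disjoint S & copy v].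
Proof.
rewrite mem_section => /eqP sv; apply/pred0P=> w /=.
rewrite mem_section mem_copy; have [->|] := eqVneq (block w) v.
  by rewrite sv eq_sym andbT andbN.
by rewrite !andbF.
Qed.

Lemma equalizer_section_notin_copy u v h k w : distance_equalizer S ->
    u != v -> inr (u, h) \notin S -> w \in S ->
    dist w (inr (u, h)) = dist w (inr (v, k)) ->
  w \notin copy u.
Proof.
move=> eqS uv hS wS w_eq; apply/negP; rewrite mem_copy => /andP[w_inl /eqP wu].
have su : s u = w by move: wS; rewrite mem_section wu => /eqP.
have uS : inl u \notin S by rewrite mem_section /= su.
have [x /setIP[xS]] := equalizer_copy_neighbor eqS uS hS.
rewrite mem_copy => /andP[_ /eqP xu].
have -> : x = w by move: xS; rewrite mem_section xu su => /eqP.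
rewrite -(dist_eq1 connected_corona) w_eq dist_copy; last first.
  by rewrite mem_copy wu (negPf uv) andbF.
rewrite eqSS (dist_eq0 connected_corona) => /eqP wv.
by rewrite -wu wv /= eqxx in uv.
Qed.

Lemma equalizer_section_equalizedT : 1 < #|H| -> distance_equalizer S ->
  forall u v, equalized [set: G] u v.
Proof.
move=> /card_gt1P[h [k [_ _ hk]]] eqS u v.
have [->|uv] := eqVneq u v; first exact: equalizedTxx.
have notin_S x : exists l, inr (x, l) \notin S.
  have [xh|xh] := boolP (inr (x, h) \in S); last by exists h.
  exists k; apply: contra hk; move: xh.
  by rewrite !mem_section /= => /eqP-> /eqP[->].
have [[l lS] [m mS]] := (notin_S u, notin_S v).
have /exists_inP[w wS /eqP w_eq] : equalized S (inr (u, l)) (inr (v, m)).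
  by apply: (distance_equalizerP _ eqS) => //; apply: contra uv => /eqP[->].
have wu := equalizer_section_notin_copy eqS uv lS wS w_eq.
have wv : w \notin copy v.
  apply: equalizer_section_notin_copy (esym w_eq) => //.
  by rewrite eq_sym.
rewrite -block_section -equalized_inl; apply/exists_inP; exists w => //.
by rewrite -eqSS -(dist_copy l wu) -(dist_copy m wv) w_eq.
Qed.

Section SingletonCopy.

Hypothesis H_singleton : #|H| = 1.

Lemma inr_section v h : (inr (v, h) \in S) = (inl v \notin S).
Proof.
have [h0 eq_h0] := fintype1 H_singleton.
rewrite !mem_section /=; have := sK v.
case: (s v) => [u /= ->|[u k] /= ->]; first by rewrite eqxx.
by rewrite (eq_h0 h) (eq_h0 k) eqxx.
Qed.

Lemma equalizer_section_admissible :
  distance_equalizer S = beta_star_admissible (missed S, ~: missed S).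
Proof.
set X := missed S.
have /card_gt0P[h _] : 0 < #|H| by rewrite H_singleton.
have disj v : v \notin X -> [disjoint S & copy v].
  by rewrite inE negbK => /disjoint_section_copy.
have inrX v k : (inr (v, k) \notin S) = (v \notin X) by rewrite inr_section inE.
have inlX v : (inl v \notin S) = (v \in X) by rewrite inE.
apply/distance_equalizerP/beta_star_admissible_setCP => [eqS|[eqXC eqX fwd]].
- split=> u v uX vX.
  + have [->|uv] := eqVneq u v; first exact: equalizedTxx.
    rewrite -block_section -(equalized_inr h h) ?disj // eqS ?inrX //.
    by apply: contra uv => /eqP[->].
  + have [->|uv] := eqVneq u v; first exact: equalizedTxx.
    by rewrite -block_section -equalized_inl eqS ?inlX.
  + by rewrite -block_section -(equalized_inl_inr _ h) ?disj // eqS ?inlX ?inrX.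
- case=> [u|[u k]] [v|[v l]]; rewrite ?inlX ?inrX => uX vX _.
  + by rewrite equalized_inl block_section eqX.
  + by rewrite equalized_inl_inr ?disj // block_section fwd.
  + by rewrite equalizedC equalized_inl_inr ?disj // block_section fwd.
  + by rewrite equalized_inr ?disj // block_section eqXC.
Qed.

End SingletonCopy.

End SectionOfBlock.

Lemma beta_eq0_xi_corona : 0 < #|H| ->
  beta (empty_bisector G) = 0 -> xi (corona G H) = #|G|.
Proof.
move=> H_gt0 /beta_empty_bisector_eq0 eqT.
have inlK : cancel (inl : G -> corona G H) block by [].
pose V : {set corona G H} := inl @: [set: G].
have inlV v : inl v \in V by rewrite mem_section.
apply/(xi_corona_eq_order H_gt0); exists inl => //.
apply/distance_equalizerP=> -[u|[u h]] [v|[v k]]; rewrite ?inlV // => _ _ _.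
by rewrite equalized_inr ?(block_section inlK) ?(disjoint_section_copy inlK).
Qed.

Lemma xi_corona_beta_eq0 : 1 < #|H| ->
  xi (corona G H) = #|G| -> beta (empty_bisector G) = 0.
Proof.
move=> H_gt1 /xi_corona_eq_order[|s sK eqS]; first exact: ltnW.
exact/beta_empty_bisector_eq0/(equalizer_section_equalizedT sK H_gt1 eqS).
Qed.

Lemma xi_corona_singleton : #|H| = 1 ->
  xi (corona G H) = #|G| <-> beta_star G = 0.
Proof.
move=> H1; have H_gt0 : 0 < #|H| by rewrite H1.
apply: (iff_trans (xi_corona_eq_order H_gt0)).
apply: iff_trans (iff_sym (beta_star_eq0 G)).
split=> [[s sK]|[X admX]].
  rewrite (equalizer_section_admissible sK H1).
  by exists (missed (s @: [set: G])).
have /card_gt0P[h _] := H_gt0.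
pose s v : corona G H := if v \in X then inr (v, h) else inl v.
have sK : cancel s block by move=> v; rewrite /s; case: ifP.
exists s => //; rewrite (equalizer_section_admissible sK H1).
suff -> : missed (s @: [set: G]) = X by [].
apply/setP=> v; rewrite inE (mem_section sK) /s /=.
by case: ifP => // _; rewrite eqxx.
Qed.

End Corona.

Theorem theorem22 (G H : sgraph) (hG : connected_graph G) (hH : 0 < #|H|) :
  xi (corona G H) = #|G| <->
  beta (empty_bisector G) = 0 \/ (#|H| = 1 /\ beta_star G = 0).
Proof.
split=> [xi_eq|[beta0|[H1 beta_star0]]].
- have [H1|H_neq1] := eqVneq #|H| 1.
    by right; split=> //; apply/(xi_corona_singleton hG H1).
  left; apply: xi_corona_beta_eq0 xi_eq => //.
  by rewrite ltn_neqAle eq_sym H_neq1.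
- exact: beta_eq0_xi_corona.
- exact/(xi_corona_singleton hG H1).
Qed.
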